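(* For every F{\o}lner sequence $(F_n)$ in $(\mathbb N,+)$ there exists an $(F_n)$-normal Liouville number.
   Context: $\mathbb N=\{1,2,\dots\}$. A F{\o}lner sequence in $(\mathbb N,+)$ is a sequence $(F_n)$ of (nonempty) finite subsets of $\mathbb N$ such that $\lim_n|F_n\cap(F_n-k)|/|F_n|=1$ for every $k\in\mathbb N$. For nonempty finite $K\subset\mathbb N$, $B\in\{0,1\}^K$ and $x\in\{0,1\}^{\mathbb N}$ put $\mathsf N(B,x,F_n)=|\{m\in\mathbb N\cup\{0\}:(\forall i\in K)\ i+m\in F_n\text{ and }x_{i+m}=B(i)\}|$. A sequence $x\in\{0,1\}^{\mathbb N}$ is $(F_n)$-normal if $\lim_n\frac1{|F_n|}\mathsf N(B,x,F_n)=2^{-|K|}$ for all such $K,B$. A real number in $[0,1]$ is $(F_n)$-normal if it has an $(F_n)$-normal binary expansion, where $(x_n)$ is a binary expansion of $\sum_{n\ge1}x_n2^{-n}$. An irrational number $x$ is a Liouville number if for every natural $k$ there is a rational $\frac pq$ with $|x-\frac pq|<\frac1{q^k}$. *)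

(* Defs.v *)
From HB Require Import structures.
From mathcomp Require Import all_boot all_order all_algebra finmap.
From mathcomp Require Import all_classical all_reals all_analysis.
Import Order.TTheory GRing.Theory Num.Theory.
Import numFieldNormedType.Exports.

Set Implicit Arguments.
Unset Strict Implicit.
Unset Printing Implicit Defensive.

Local Open Scope classical_set_scope.
Local Open Scope ring_scope.

(* A finite subset of {1, 2, ...} is an A : {fset nat} with 0%N \notin A, and a
   sequence in {0,1}^{1, 2, ...} is an x : nat -> bool whose value at 0 is never
   consulted by the definitions below. *)

Definition folner_sequence (R : realType) (F : nat -> {fset nat}) : Prop :=
  [/\ forall n, F n != fset0,
      forall n, 0%N \notin F n &
      forall k : nat, (0 < k)%N ->
        (fun n => #|` [fset m in F n | (m + k)%N \in F n]%fset |%:R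
                  / #|` F n|%:R : R) @ \oo --> (1 : R)].

Definition occurrences (K : {fset nat}) (B : {ffun K -> bool})
    (x : nat -> bool) (A : {fset nat}) : set nat :=
  [set m | forall i : K, (fsval i + m)%N \in A /\ x (fsval i + m)%N = B i].

(* fset_set is meaningful only on finite sets, which is why K must be nonempty *)
Lemma finite_occurrences (K : {fset nat}) (B : {ffun K -> bool})
    (x : nat -> bool) (A : {fset nat}) :
  K != fset0 -> finite_set (occurrences B x A).
Proof.
case/fset0Pn => i iK.
apply: (@sub_finite_set _ _ [set` [fset (a - i)%N | a in A]%fset]); last first.
  exact: finite_fset.
move=> m /(_ [` iK]%fset) [/= imA _] /=.
by apply/imfsetP; exists (i + m)%N => //=; rewrite addKn.
Qed.

Definition count_occurrences (K : {fset nat}) (B : {ffun K -> bool})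
    (x : nat -> bool) (A : {fset nat}) : nat :=
  #|` fset_set (occurrences B x A)|.

Definition normal_sequence (R : realType) (F : nat -> {fset nat})
    (x : nat -> bool) : Prop :=
  forall (K : {fset nat}) (B : {ffun K -> bool}),
    K != fset0 -> 0%N \notin K ->
    (fun n => (#|` F n|%:R)^-1 * (count_occurrences B x (F n))%:R : R) @ \oo
      --> ((2^-1) ^+ #|` K| : R).

Definition binary_expansion (R : realType) (x : nat -> bool) (r : R) : Prop :=
  (fun n => \sum_(1 <= k < n) (x k)%:R * 2 ^- k : R) @ \oo --> r.

Definition normal_number (R : realType) (F : nat -> {fset nat}) (r : R) : Prop :=
  0 <= r <= 1 /\
  exists x : nat -> bool, binary_expansion x r /\ normal_sequence R F x.

(* The denominator must exceed 1: with q = 1 allowed, every real number would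
   satisfy the inequality for all k, taking p := floor r. *)
Definition liouville_number (R : realType) (r : R) : Prop :=
  irrational r /\
  forall k : nat, (0 < k)%N ->
    exists (p : int) (q : nat), (1 < q)%N /\ `|r - p%:~R / q%:R| < q%:R ^- k.

(* Main.v *)
Require Import Defs.
From mathcomp Require Import all_boot all_order all_algebra finmap.
From mathcomp Require Import all_classical all_reals all_analysis.
From mathcomp Require Import zify ring lra.
Import Order.TTheory GRing.Theory Num.Theory.
Import numFieldNormedType.Exports.

Set Implicit Arguments.
Unset Strict Implicit.
Unset Printing Implicit Defensive.

Local Open Scope ring_scope.

(** The digits of the number are those of a word periodic on very long blocks:
    between [a t] and [a t.+1] they repeat the concatenation of all binary words
    of length [t.+1].

    Such a number is close to rationals. The expansion that keeps the period of
    block [t] forever is that of a rational with denominator less than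
    [2 ^ (a t + period t)], and agrees with the constructed one up to [a t.+1]; if
    [a t.+1] is large compared with [(a t + period t) * t], the approximation is
    of order [t]. This is [approximation_of_period].

    Such a number is also normal, provided the blocks grow slowly along the
    Følner sequence. Each block repeats a word in which every short pattern has
    nearly its expected frequency, because each word of length [t.+1] appears
    once per period ([champernowne_period_count]). Almost invariance of a
    Følner set under translations replaces the frequency of a pattern on that set
    by the mean, over the set, of its frequencies on windows
    ([dist_sum_window]), and a window inside one block is almost exact. What has
    to be arranged is that the periods met by a Følner set are short compared
    with the scale of its invariance, although the sets may lie anywhere and grow
    arbitrarily slowly. As the set of index [n] is finite, it suffices to postpone
    each new block beyond all the sets whose index is too small for its period
    ([exists_scales]); each set then essentially meets two consecutive blocks
    only, and [stage_estimate] bounds the error by a constant over [t.+1].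

    Irrationality comes from normality: every pattern occurs, so the expansion has
    arbitrarily long runs of zeros and infinitely many ones, and the fractional
    parts of [2 ^ n * r] are positive and arbitrarily small
    ([irrational_of_digits]). *)

(** * Sums over almost invariant sets *)

(** The number of points of a set pushed out of it by the translation by [k]:
    it measures the failure of invariance under that translation, and a Følner
    sequence is one for which it is negligible against the cardinality. *)
Definition escape (A : seq nat) (k : nat) : nat :=
  count (fun m => (m + k)%N \notin A) A.

Lemma sum_indicator (R : realType) (I : Type) (s : seq I) (p : pred I) :
  \sum_(m <- s) (p m)%:R = (count p s)%:R :> R.
Proof.
rewrite -sum1_count natr_sum [RHS]big_mkcond.
by apply: eq_bigr => m _; case: (p m).
Qed.

(** The translates that stay in [A] are distinct points of [A], so their terms
    are bounded by the sum over [A]; each of the others contributes at most 1. *)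
Lemma sum_shift_le (R : realType) (A : seq nat) (f : nat -> R) (k : nat) :
  uniq A -> (forall m, 0 <= f m <= 1) ->
  \sum_(m <- A) f (m + k)%N <= \sum_(m <- A) f m + (escape A k)%:R.
Proof.
move=> uA f01; rewrite (bigID (fun m => (m + k)%N \in A)) /=; apply: lerD.
  rewrite -big_filter -(big_map (addn^~ k) predT f).
  set G := map _ _.
  have uG : uniq G by rewrite map_inj_uniq ?filter_uniq // => a b /= /addIn.
  rewrite (perm_big [seq m <- A | m \in G]); last first.
    apply: uniq_perm => //; first exact: filter_uniq.
    move=> m; rewrite mem_filter; case: (boolP (m \in G)) => //= mG.
    by case/mapP: mG => b; rewrite mem_filter => /andP[bA _] ->.
  rewrite big_filter big_mkcond /=; apply: ler_sum => m _.
  by case: ifP => // _; case/andP: (f01 m).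
rewrite -sum_indicator big_mkcond /=; apply: ler_sum => m _.
by case: ifP => // _; case/andP: (f01 (m + k)%N).
Qed.

(** The one-sided bound applied to both [f] and [1 - f]. *)
Lemma dist_sum_shift (R : realType) (A : seq nat) (f : nat -> R) (k : nat) :
  uniq A -> (forall m, 0 <= f m <= 1) ->
  `|\sum_(m <- A) f (m + k)%N - \sum_(m <- A) f m| <= (escape A k)%:R.
Proof.
move=> uA f01; have le1 := sum_shift_le k uA f01.
have f01' m : 0 <= 1 - f m <= 1 by have := f01 m; lra.
have := sum_shift_le k uA f01'; rewrite !sumrB.
by rewrite ler_norml; lra.
Qed.

(** On an almost invariant set, a sum of [f] can be replaced by a sum of its
    moving averages: it then suffices that [f] has the right mean on every
    window. *)
Lemma dist_sum_window (R : realType) (A : seq nat) (f : nat -> R) (S : nat) :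
  uniq A -> (forall m, 0 <= f m <= 1) ->
  `|\sum_(m <- A) \sum_(k < S) f (m + k)%N - S%:R * \sum_(m <- A) f m|
    <= \sum_(k < S) (escape A k)%:R.
Proof.
move=> uA f01; rewrite exchange_big /=.
have -> : S%:R * \sum_(m <- A) f m = \sum_(k < S) \sum_(m <- A) f m.
  by rewrite sumr_const card_ord mulr_natl.
rewrite -sumrB; apply: le_trans (ler_norm_sum _ _ _) _.
by apply: ler_sum => k _; apply: dist_sum_shift.
Qed.

Lemma sum_close_off_bad (R : realType) (A bad : seq nat) (W : nat -> R) (w e S : R) :
  uniq A -> 0 <= e -> 0 <= S ->
  (forall m, m \in A -> m \notin bad -> `|W m - w| <= e) ->
  (forall m, `|W m - w| <= S) ->
  `|\sum_(m <- A) W m - (size A)%:R * w| <= (size A)%:R * e + (size bad)%:R * S.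
Proof.
move=> uA e0 S0 good crude.
have -> : (size A)%:R * w = \sum_(m <- A) w.
  by rewrite big_const_seq count_predT iter_addr addr0 mulr_natl.
rewrite -sumrB; apply: le_trans (ler_norm_sum _ _ _) _.
apply: (@le_trans _ _ (\sum_(m <- A) (e + (m \in bad)%:R * S))).
  rewrite big_seq [leRHS]big_seq; apply: ler_sum => m mA.
  case: (boolP (m \in bad)) => mb /=.
    by rewrite mul1r; have := crude m; lra.
  by rewrite mul0r addr0; apply: good.
rewrite big_split /= big_const_seq count_predT iter_addr addr0 -[e *+ _]mulr_natl.
rewrite lerD2l -mulr_suml ler_wpM2r // sum_indicator ler_nat -size_filter.
apply: uniq_leq_size; first exact: filter_uniq.
by move=> m; rewrite mem_filter => /andP[].
Qed.

Definition matches (K : {fset nat}) (B : {ffun K -> bool}) (x : nat -> bool)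
    (m : nat) : bool :=
  [forall i : K, x (fsval i + m)%N == B i].

(** An occurrence must lie inside [A] as a whole, but on an almost invariant set
    this hardly matters: translating by one position [i0] of the pattern moves
    all occurrences into [A], at the cost of [escape A i0], and a point of [A]
    where the pattern is read fails to be an occurrence only when some position
    escapes. *)
Lemma count_occurrences_close (R : realType) (K : {fset nat}) (B : {ffun K -> bool})
    (x : nat -> bool) (A : {fset nat}) :
  K != fset0 ->
  exists2 i0, i0 \in K &
  `|(count_occurrences B x A)%:R - \sum_(m <- A) (matches B x m)%:R| <=
   (escape A i0)%:R + \sum_(i : K) (escape A (fsval i))%:R :> R.
Proof.
move=> K0; have finO := @finite_occurrences K B x A K0.
have /fset0Pn[i0 i0K] := K0; exists i0 => //.
have occP m : (m \in fset_set (occurrences B x A)) =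
    matches B x m && [forall i : K, (fsval i + m)%N \in A].
  rewrite in_fset_set //; apply/idP/idP.
    move/set_mem => /= H; apply/andP; split; apply/forallP => i; first by case: (H i) => _ ->.
    by case: (H i).
  move=> /andP[/forallP H1 /forallP H2]; apply/mem_set => /= i.
  by split; [apply: H2|apply/eqP/H1].
pose O := fset_set (occurrences B x A).
(* The indicator of the set of occurrences translated by [i0]. *)
pose f (m : nat) : R := ((i0 <= m)%N && ((m - i0)%N \in O))%:R.
have f01 m : 0 <= f m <= 1 by rewrite /f ler0n lern1 leq_b1.
have shift := @dist_sum_shift R A f i0 (fset_uniq A) f01.
have cO : \sum_(m <- A) f m = (count_occurrences B x A)%:R.
  rewrite sum_indicator /count_occurrences -/O -size_filter; congr _%:R.
  rewrite -(size_map (addn^~ i0) O); apply/perm_size/uniq_perm.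
  - by apply: filter_uniq; exact: fset_uniq.
  - by rewrite map_inj_uniq ?fset_uniq // => a b /addIn.
  move=> m; rewrite mem_filter; apply/idP/mapP.
    by move=> /andP[/andP[im mO] _]; exists (m - i0)%N => //; rewrite subnK.
  move=> [b bO ->]; rewrite leq_addl addnK bO /=.
  move: bO; rewrite occP => /andP[_ /forallP/(_ [` i0K]%fset)] /=.
  by rewrite addnC.
have cO' m : f (m + i0)%N = (m \in O)%:R by rewrite /f leq_addl addnK.
have inner : `|\sum_(m <- A) f (m + i0)%N - \sum_(m <- A) (matches B x m)%:R|
    <= \sum_(i : K) (escape A (fsval i))%:R.
  have -> : \sum_(i : K) (escape A (fsval i))%:R =
      \sum_(m <- A) \sum_(i : K) ((m + fsval i)%N \notin A)%:R :> R.
    by rewrite exchange_big /=; apply: eq_bigr => i _; rewrite sum_indicator.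
  rewrite -sumrB; apply: le_trans (ler_norm_sum _ _ _) _.
  apply: ler_sum => m _; rewrite cO' occP.
  case: (matches B x m) => /=; last by rewrite subrr normr0 sumr_ge0.
  case: (boolP [forall i : K, _]) => [_|]; first by rewrite subrr normr0 sumr_ge0.
  rewrite negb_forall => /existsP[i iA]; rewrite (bigD1 i) //= addnC iA.
  by rewrite sub0r normrN normr1 lerDl sumr_ge0.
rewrite -cO -[X in `|X|](subrKA (\sum_(m <- A) f (m + i0)%N)).
apply: le_trans (ler_normD _ _) (lerD _ inner).
by rewrite distrC.
Qed.

(** * Concatenations of all words of a given length *)

(** Prescribing the values at [#|I|] distinct points leaves the others free. *)
Lemma card_ffun_prescribed (I T : finType) (phi : I -> T) (b : I -> bool) :
  injective phi ->
  (#|[pred f : {ffun T -> bool} | [forall i, f (phi i) == b i]]| * 2 ^ #|I| = 2 ^ #|T|)%N.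
Proof.
move=> inj.
pose F (t : T) : pred bool :=
  [pred v | if [pick i | phi i == t] is Some i then v == b i else true].
have -> : #|[pred f : {ffun T -> bool} | [forall i, f (phi i) == b i]]| = #|family F|.
  apply: eq_card => f; rewrite !inE; apply/forallP/familyP => [H t|H i].
    rewrite /F inE; case: pickP => // i /eqP <-; exact: H.
  have := H (phi i); rewrite /F inE; case: pickP => [j /eqP /inj -> //|/(_ i)].
  by rewrite eqxx.
rewrite card_family foldrE big_map big_enum /=.
rewrite (eq_bigr (fun t => if t \in codom phi then 1 else 2)%N); last first.
  move=> t _; rewrite /F; case: pickP => [i /eqP <-|H].
    by rewrite codom_f /= (@fintype.eq_card1 _ (b i)) // => v; rewrite !inE.
  rewrite ifN; first by rewrite (@eq_card _ _ predT) ?card_bool // => v; rewrite !inE.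
  by apply/negP => /codomP[i ti]; move: (H i); rewrite ti eqxx.
rewrite (bigID (mem (codom phi))) /= big1 ?mul1n; last by move=> t ->.
rewrite (eq_bigr (fun=> 2)); last by move=> t /negPf ->.
rewrite prod_nat_const -expnD -(card_codom inj) addnC.
by rewrite -(cardC (mem (codom phi))).
Qed.

(** The concatenation of all binary words of length [l.+1], repeated forever;
    the length is a successor so that it is never zero. *)
Definition champernowne (l m : nat) : bool :=
  nth [ffun => false] (enum {ffun 'I_l.+1 -> bool}) ((m %/ l.+1) %% 2 ^ l.+1)
    (inord (m %% l.+1)).

Definition period (l : nat) : nat := (2 ^ l.+1 * l.+1)%N.

Lemma champernowne_periodic (l m q : nat) :
  champernowne l (q * period l + m) = champernowne l m.
Proof.
rewrite /champernowne /period mulnA divnMDl // modnMDl.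
by rewrite modnMDl.
Qed.

Lemma sum_ord_mul (V : nmodType) (p n : nat) (f : nat -> V) :
  \sum_(k < p * n) f k = \sum_(j < p) \sum_(o < n) f (j * n + o)%N.
Proof.
elim: p => [|p IH]; first by rewrite mul0n !big_ord0.
by rewrite mulSnr big_split_ord /= IH big_ord_recr.
Qed.

(** When the pattern read from offset [o] fits inside one word, letting the word
    vary over all words of that length makes its symbols independent and
    uniform: the frequency is exact. *)
Lemma champernowne_column (R : realType) (l o : nat) (K : {fset nat})
    (B : {ffun K -> bool}) :
  (forall i : K, o + fsval i < l.+1)%N ->
  \sum_(j < 2 ^ l.+1) (matches B (champernowne l) (j * l.+1 + o))%:R
    = (2 ^ l.+1)%:R * (2^-1) ^+ #|` K| :> R.
Proof.
move=> oK.
pose p := [pred f : {ffun 'I_l.+1 -> bool} |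
  [forall i : K, f (inord (o + fsval i)) == B i]].
have sz : size (enum {ffun 'I_l.+1 -> bool}) = (2 ^ l.+1)%N.
  by rewrite -cardE card_ffun card_bool card_ord.
have -> : \sum_(j < 2 ^ l.+1) (matches B (champernowne l) (j * l.+1 + o))%:R
   = #|p|%:R :> R.
  rewrite cardE [enum p]/enum_mem size_filter -sum_indicator -enumT.
  rewrite (big_nth [ffun => false]) sz big_mkord; apply: eq_bigr => j _.
  congr (nat_of_bool _)%:R; apply: eq_forallb => i.
  rewrite /champernowne addnCA divnMDl // modnMDl (addnC (fsval i)).
  by rewrite divn_small ?oK // addn0 !modn_small.
have inj : injective (fun i : K => inord (o + fsval i) : 'I_l.+1).
  move=> i j /(congr1 val); rewrite /= !inordK ?oK // => /addnI.
  exact: val_inj.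
have := card_ffun_prescribed B inj; rewrite card_ord -cardfE => <-.
by rewrite natrM natrX -mulrA -exprMn mulfV ?pnatr_eq0 // expr1n mulr1.
Qed.

(** The only offsets not covered by the exact count are the last [M] of each
    word, where the pattern may overflow into the next word. *)
Lemma champernowne_period_count (R : realType) (l M : nat) (K : {fset nat})
    (B : {ffun K -> bool}) :
  (forall i : K, fsval i <= M)%N ->
  `|\sum_(k < period l) (matches B (champernowne l) k)%:R
      - (period l)%:R * (2^-1) ^+ (#|` K|) | <= (2 ^ l.+1 * M)%:R :> R.
Proof.
move=> KM; set c := _ ^+ _.
have c01 : 0 <= c <= 1 by rewrite exprn_ge0 ?invr_ge0 //= exprn_ile1 ?invr_ge0 // invf_le1 // ler1n.
rewrite /period (sum_ord_mul _ _ (fun k => (matches B (champernowne l) k)%:R)) exchange_big /=.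
have -> : (2 ^ l.+1 * l.+1)%:R * c = \sum_(o < l.+1) (2 ^ l.+1)%:R * c.
  by rewrite sumr_const card_ord -mulr_natl natrM; ring.
rewrite -sumrB; apply: le_trans (ler_norm_sum _ _ _) _.
apply: (@le_trans _ _ (\sum_(o < l.+1) (2 ^ l.+1)%:R * (l.+1 <= o + M)%:R)).
  apply: ler_sum => o _; case: (leqP l.+1 (o + M)) => oM /=.
    rewrite mulr1.
    have : 0 <= \sum_(j < 2 ^ l.+1) (matches B (champernowne l) (j * l.+1 + o))%:R :> R.
      by apply: sumr_ge0.
    have : \sum_(j < 2 ^ l.+1) (matches B (champernowne l) (j * l.+1 + o))%:R
        <= (2 ^ l.+1)%:R :> R.
      rewrite -[X in _ <= X%:R]card_ord -sumr_const; apply: ler_sum => j _.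
      by rewrite lern1 leq_b1.
    have : 0 <= (2 ^ l.+1)%:R :> R by [].
    by rewrite ler_norml; move: ((2 ^ l.+1)%:R : R) => e; nra.
  rewrite champernowne_column ?subrr ?normr0 ?mulr0 // => i.
  by apply: leq_ltn_trans oM; rewrite leq_add2l.
rewrite -mulr_sumr natrM ler_wpM2l //.
rewrite -natr_sum ler_nat.
have gen n : (\sum_(o < n) (l.+1 <= o + M)%N <= n + M - l.+1)%N.
  elim: n => [|n IH]; first by rewrite big_ord0.
  rewrite big_ord_recr /=; apply: leq_trans (leq_add IH (leqnn _)) _; lia.
by apply: leq_trans (gen _) _; lia.
Qed.

(** * Binary expansions, irrationality and approximation *)

Definition digit_sum (R : realType) (x : nat -> bool) (n : nat) : R :=
  \sum_(1 <= k < n) (x k)%:R * 2 ^- k.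

(** What remains of the expansion after the first [n] digits, shifted back to
    start at the binary point: the fractional part of [2 ^ n * r], except that it
    can also be 1. *)
Definition tail (R : realType) (x : nat -> bool) (r : R) (n : nat) : R :=
  2 ^+ n * (r - digit_sum R x n.+1).

Lemma digit_sumS (R : realType) (x : nat -> bool) (n : nat) :
  digit_sum R x n.+2 = digit_sum R x n.+1 + (x n.+1)%:R * 2 ^- n.+1.
Proof. by rewrite /digit_sum big_nat_recr. Qed.

(** The partial sums increase while the partial sums plus [2 ^- n] decrease, so
    the limit is trapped between them. *)
Lemma binary_expansion_exists (R : realType) (x : nat -> bool) :
  exists2 r : R, binary_expansion x r & forall n, 0 <= tail x r n <= 1.
Proof.
have S0 : digit_sum R x 0 = digit_sum R x 1 by rewrite /digit_sum !big_geq.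
have nd : nondecreasing_seq (digit_sum R x).
  apply/nondecreasing_seqP => -[|n]; first by rewrite S0.
  by rewrite digit_sumS lerDl mulr_ge0.
have half n : 2 ^- n.+1 + 2 ^- n.+1 = 2 ^- n :> R.
  by rewrite exprS invfM; lra.
have ni : nonincreasing_seq (fun n => digit_sum R x n.+1 + 2 ^- n).
  apply/nonincreasing_seqP => n; rewrite digit_sumS -(half n) -addrA lerD2l.
  by rewrite lerD2r; case: (x n.+1); rewrite ?mul1r ?mul0r.
have up m n : digit_sum R x m <= digit_sum R x n.+1 + 2 ^- n.
  apply: (@le_trans _ _ (digit_sum R x (maxn m n).+1)).
    by apply: nd; rewrite leqW // leq_maxl.
  apply: le_trans (ni n (maxn m n) (leq_maxr _ _)).
  by rewrite lerDl.
have cvg : cvgn (digit_sum R x).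
  apply: nondecreasing_is_cvgn => //.
  by exists (digit_sum R x 1 + 2 ^- 0) => _ [n _ <-]; apply: up.
exists (limn (digit_sum R x)) => // n.
have lo : digit_sum R x n.+1 <= limn (digit_sum R x).
  exact: nondecreasing_cvgn_le.
have hi : limn (digit_sum R x) <= digit_sum R x n.+1 + 2 ^- n.
  by apply: limr_le => //; near=> m; apply: up.
rewrite /tail mulr_ge0 ?subr_ge0 //=.
by rewrite mulrC -ler_pdivlMr ?exprn_gt0 // mul1r lerBlDl.
Unshelve. all: by end_near. Qed.

Lemma tailE (R : realType) (x : nat -> bool) (r : R) (n : nat) :
  tail x r n = ((x n.+1)%:R + tail x r n.+1) / 2.
Proof.
rewrite /tail digit_sumS exprS; have : 2 ^+ n != 0 :> R by rewrite expf_neq0.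
by set e := 2 ^+ n => e0; field.
Qed.

Lemma tail_int (R : realType) (x : nat -> bool) (r : R) (n : nat) :
  exists z : int, 2 ^+ n * r = z%:~R + tail x r n.
Proof.
suff [z hz] : exists z : int, 2 ^+ n * digit_sum R x n.+1 = z%:~R.
  by exists z; rewrite -hz /tail; ring.
elim: n => [|n [z hz]]; first by exists 0; rewrite /digit_sum big_geq // mulr0.
exists (2 * z + (x n.+1)%:R).
rewrite digit_sumS mulrDr exprS -mulrA hz rmorphD rmorphM /= mulrCA mulfV ?mulr1.
  by rewrite natz; case: (x n.+1).
by rewrite mulf_neq0 ?expf_neq0.
Qed.

(** Dropping one common digit halves the distance between two tails. *)
Lemma tail_agree (R : realType) (x : nat -> bool) (r : R) (L m n : nat) :
  (forall n, 0 <= tail x r n <= 1) ->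
  (forall k, 0 < k <= L -> x (m + k) = x (n + k))%N ->
  `|tail x r m - tail x r n| <= 2 ^- L.
Proof.
move=> tail01; elim: L m n => [|L IH] m n agree.
  by rewrite expr0 invr1 ler_norml; have := tail01 m; have := tail01 n; lra.
have h : `|tail x r m.+1 - tail x r n.+1| <= 2 ^- L.
  by apply: IH => k kL; rewrite !addSnnS; apply: agree; lia.
rewrite (tailE x r m) (tailE x r n) -(addn1 m) -(addn1 n) (agree 1%N) //.
rewrite -mulrBl opprD addrACA subrr add0r normrM [X in _ * X]ger0_norm //.
by rewrite exprSr invfM ler_wpM2r // (addn1 m) (addn1 n).
Qed.

Lemma tail_zeros (R : realType) (x : nat -> bool) (r : R) (L n : nat) :
  (forall n, 0 <= tail x r n <= 1) ->
  (forall k, 0 < k <= L -> x (n + k) = false)%N -> tail x r n <= 2 ^- L.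
Proof.
move=> tail01; elim: L n => [|L IH] n zeros; first by rewrite expr0 invr1; case/andP: (tail01 n).
rewrite tailE -(addn1 n) zeros // add0r exprSr invfM mulrC [leRHS]mulrC ler_wpM2l // (addn1 n).
by apply: IH => k kL; rewrite addSnnS; apply: zeros; lia.
Qed.

Lemma tail_gt0 (R : realType) (x : nat -> bool) (r : R) (n k : nat) :
  (forall n, 0 <= tail x r n <= 1) -> x (n + k).+1 -> 0 < tail x r n.
Proof.
move=> tail01; elim: k n => [|k IH] n xk; rewrite tailE.
  by move: xk; rewrite addn0 => -> /=; have := tail01 n.+1; lra.
have : 0 < tail x r n.+1 by apply: IH; rewrite addSnnS.
by have : 0 <= (x n.+1)%:R :> R by []; lra.
Qed.

(** If [r = a / b] then [b] times each tail is an integer; it is positive because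
    a digit 1 follows, yet a run of [b] zeros makes it less than [b * 2 ^- b],
    hence less than 1. *)
Lemma irrational_of_digits (R : realType) (x : nat -> bool) (r : R) :
  (forall n, 0 <= tail x r n <= 1) ->
  (forall L, exists n, forall k, 0 < k <= L -> x (n + k) = false)%N ->
  (forall n, exists k, x (n + k).+1) -> irrational r.
Proof.
move=> tail01 zeros ones /rationalP[a [b rab]]; have {a b rab}[a [b b0 rab]] :
    exists a : int, exists2 b : nat, (0 < b)%N & r * b%:R = a%:~R.
  (* Division by zero yields 0, so [r = a / 0] is the fraction [0 / 1]. *)
  case: b rab => [|b] rab; first by exists 0, 1%N; rewrite // rab invr0 mulr0 mul0r.
  by exists a, b.+1 => //; rewrite rab divfK.
have [n zn] := zeros b; have [k ok] := ones n.
have [z hz] := tail_int x r n.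
have t0 := tail_gt0 tail01 ok; have tb := tail_zeros tail01 zn.
pose c : int := 2 ^+ n * a - z * b%:Z.
have hc : tail x r n * b%:R = c%:~R.
  rewrite /c rmorphB !rmorphM rmorphXn /= -rab mulrA hz; ring.
have : 0 < c by rewrite -(ltr0z R) -hc mulr_gt0 // ltr0n.
have : c < 1.
  rewrite -(ltrz1 R) -hc; apply: (@le_lt_trans _ _ (2 ^- b * b%:R)).
    by rewrite ler_wpM2r.
  rewrite mulrC ltr_pdivrMr ?exprn_gt0 // mul1r -natrX ltr_nat.
  exact: ltn_expl.
by lia.
Qed.

(** For [q = 2 ^ a * (2 ^ P - 1) = 2 ^ (a + P) - 2 ^ a], the number [q * r] is
    an integer plus the difference of the tails at [a + P] and [a]. When the
    digits have period [P] from [a] up to [a'], these tails agree for about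
    [a' - a - P] digits, so [r] is within [2 ^- ((a + P) * k) / q] of a fraction
    with denominator [q < 2 ^ (a + P)]. *)
Lemma approximation_of_period (R : realType) (x : nat -> bool) (r : R) (a P a' k : nat) :
  (forall n, 0 <= tail x r n <= 1) ->
  (1 < P)%N -> ((a + P) * k.+1 < a')%N ->
  (forall m, a <= m -> m + P < a' -> x (m + P) = x m)%N ->
  exists (p : int) (q : nat), (1 < q)%N /\ `|r - p%:~R / q%:R| < q%:R ^- k.
Proof.
move=> tail01 P1 aa' per.
have [z hz] := tail_int x r a; have [w hw] := tail_int x r (a + P).
pose q := (2 ^ a * (2 ^ P - 1))%N.
have q1 : (1 < q)%N.
  have : (2 ^ 2 <= 2 ^ P)%N by rewrite leq_exp2l.
  have : (0 < 2 ^ a)%N by rewrite expn_gt0.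
  by rewrite /q; nia.
exists (w - z), q; split => //.
have qE : q%:R = 2 ^+ (a + P) - 2 ^+ a :> R.
  by rewrite /q natrM natrB ?expn_gt0 // !natrX exprD; ring.
have q0 : 0 < q%:R :> R by rewrite ltr0n ltnW.
have -> : r - (w - z)%:~R / q%:R = (tail x r (a + P) - tail x r a) / q%:R.
  rewrite rmorphB /= -{1}(mulfK (lt0r_neq0 q0) r) -mulrBl qE mulrBr.
  by rewrite ![r * _]mulrC hw hz; congr (_ / _); ring.
rewrite normrM normfV (gtr0_norm q0) ltr_pdivrMr //.
pose L := ((a + P) * k)%N.
have agr : `|tail x r (a + P) - tail x r a| <= 2 ^- L.
  by apply: tail_agree => // j jL; rewrite addnAC per //; lia.
apply: le_lt_trans agr _; rewrite mulrC -[ltLHS]div1r.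
rewrite ltr_pdivlMr ?exprn_gt0 // mulrAC ltr_pdivrMr ?exprn_gt0 // mul1r.
rewrite -!natrX -natrM ltr_nat /L.
have qlt : (q < 2 ^ (a + P))%N.
  by rewrite expnD /q ltn_mul2l expn_gt0 /=; have : (0 < 2 ^ P)%N; [rewrite expn_gt0|lia].
apply: (@leq_ltn_trans ((2 ^ (a + P)) ^ k)%N); last first.
  by rewrite expnM ltn_Pmull // !expn_gt0.
by case: (k) => // j; rewrite leq_exp2r // ltnW.
Qed.

(** * Blocks adapted to a Følner sequence *)

(** The largest element escapes. *)
Lemma escape_gt0 (A : seq nat) : (0 < size A)%N -> (0 < escape A 1)%N.
Proof.
move=> A0; rewrite -has_count; apply/negPn/negP => /hasPn closed.
have [m mA] : exists m, m \in A by case: A A0 {closed} => // m s; exists m; rewrite mem_head.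
have up j : (m + j)%N \in A.
  elim: j => [|j IH]; first by rewrite addn0.
  by have /= := closed _ IH; rewrite negbK addn1 addnS.
have := leq_bigmax_seq (P := xpredT) (F := id) _ (up (\max_(k <- A) k).+1) isT => /=; lia.
Qed.

Lemma folner_escape (R : realType) (F : nat -> {fset nat}) (t k : nat) :
  folner_sequence R F -> (0 < k)%N ->
  exists N, forall n, (N <= n)%N -> (t * escape (F n) k <= #|` F n|)%N.
Proof.
case=> F0 _ cvgF k0; case: t => [|t]; first by exists 0%N => n _; rewrite mul0n.
have /cvgrPdist_le /(_ t.+1%:R^-1) := cvgF k k0.
rewrite invr_gt0 ltr0n => /(_ isT) [N _ near1]; exists N => n Nn.
have Fn0 : 0 < #|` F n|%:R :> R by rewrite ltr0n cardfs_gt0.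
have := near1 n Nn.
have -> : #|` [fset m in F n | (m + k)%N \in F n]%fset | = (#|` F n| - escape (F n) k)%N.
  rewrite -(count_predC (fun m => (m + k)%N \in F n) (F n)) addnK -size_filter.
  apply/perm_size/uniq_perm; rewrite ?filter_uniq ?fset_uniq //.
  by move=> m; rewrite mem_filter !inE andbC.
rewrite natrB ?count_size // mulrBl divff ?gt_eqF // opprB addrC subrK.
move/(le_trans (ler_norm _)); rewrite ler_pdivrMr // mulrC ler_pdivlMr ?ltr0n //.
by rewrite -natrM ler_nat mulnC.
Qed.

(** At least one point escapes the translation by 1, yet only a small proportion
    does: the cardinalities tend to infinity. *)
Lemma folner_size (R : realType) (F : nat -> {fset nat}) (t : nat) :
  folner_sequence R F ->
  exists N, forall n, (N <= n)%N -> (t <= #|` F n|)%N.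
Proof.
move=> hF; have [N hN] := folner_escape t hF (ltn0Sn 0); exists N => n Nn.
apply: leq_trans (hN n Nn); rewrite leq_pmulr // escape_gt0 // cardfs_gt0.
by case: hF.
Qed.

(** A length divisible by the periods of two consecutive stages, so that a window
    lying in either of them consists of complete periods. *)
Definition window (t : nat) : nat := (period t * period t.+1)%N.

Lemma folner_threshold (R : realType) (F : nat -> {fset nat}) (t s u : nat) :
  folner_sequence R F ->
  exists N, forall n, (N <= n)%N -> (u <= #|` F n|)%N /\
    forall k, (0 < k <= s)%N -> (t * escape (F n) k <= #|` F n|)%N.
Proof.
move=> hF; elim: s => [|s [N hN]].
  by have [N hN] := folner_size u hF; exists N => n /hN; split=> // k; lia.
have [N' hN'] := folner_escape t hF (ltn0Sn s); exists (maxn N N') => n.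
rewrite geq_max => /andP[/hN [un kn] /hN' sn]; split=> // k /andP[k0].
rewrite leq_eqVlt => /orP[/eqP -> //|ks]; apply: kn; lia.
Qed.

(** The numbers [a t] will separate the blocks of digits, and [N t] is the index
    from which the Følner sets are large and invariant at the scale of stage
    [t]. The two sequences are built together: [N t] is chosen once [a t] is
    known, so that the sets of index at least [N t] hardly meet the integers
    below [a t], and [a t.+1] is then taken beyond all sets of index less than
    [N t], finitely many finite sets. A set of index between [N t] and [N t.+1]
    therefore essentially lies between [a t] and [a t.+2]. *)
Lemma exists_scales (R : realType) (F : nat -> {fset nat}) :
  folner_sequence R F ->
  exists a N : nat -> nat,
  [/\ forall t, ((a t + period t) * t.+2 < a t.+1)%N,
      forall t, (t <= N t)%N,
      forall t n, (N t <= n)%N -> (t.+1 * (a t + 2 * window t) <= #|` F n|)%N,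
      forall t n k, (N t <= n)%N -> (0 < k <= window t)%N ->
        (t.+1 * escape (F n) k <= #|` F n|)%N &
      forall t n m, (n < N t)%N -> m \in F n -> (m + 2 * window t <= a t.+1)%N].
Proof.
move=> hF.
have thr (p : nat * nat) : exists N, (p.1 <= N)%N /\ forall n, (N <= n)%N ->
    (p.1.+1 * (p.2 + 2 * window p.1) <= #|` F n|)%N /\
    forall k, (0 < k <= window p.1)%N -> (p.1.+1 * escape (F n) k <= #|` F n|)%N.
  have [N hN] := folner_threshold p.1.+1 (window p.1) (p.1.+1 * (p.2 + 2 * window p.1)) hF.
  exists (maxn p.1 N); split; first exact: leq_maxl.
  by move=> n; rewrite geq_max => /andP[_]; apply: hN.
have [N hN] := choice thr.
pose next t b := ((b + period t) * t.+2 +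
  \max_(n < N (t, b)) \max_(m <- F n) m + 2 * window t).+1.
pose a := fix a t := if t is s.+1 then next s (a s) else 0%N.
exists a, (fun t => N (t, a t)); split=> [t|t|t n tn|t n k tn|t n m tn mF].
- by rewrite /= /next; lia.
- by have [] := hN (t, a t).
- by have [_ /(_ n tn)[]] := hN (t, a t).
- by have [_ /(_ n tn)[_]] := hN (t, a t); apply.
have h1 : (m <= \max_(j <- F n) j)%N by exact: (leq_bigmax_seq (P := xpredT) (F := id)).
have h2 := leq_bigmax (F := fun n : 'I_(N (t, a t)) => \max_(j <- F n) j) (Ordinal tn).
have {h1 h2} := leq_trans h1 h2.
rewrite (_ : a t.+1 = next t (a t)) // /next => h.
by apply: leqW; rewrite leq_add2r (leq_trans h) // leq_addl.
Qed.

Lemma exists_stage (N : nat -> nat) (T : nat) :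
  (forall t, t <= N t)%N ->
  exists n0, forall n, (n0 <= n)%N -> exists t, [/\ (T <= t)%N, (N t <= n)%N & (n < N t.+1)%N].
Proof.
move=> tN; exists (\max_(t < T.+1) N t) => n n0.
have below t : (t <= T)%N -> (N t <= n)%N.
  move=> tT; apply: leq_trans n0.
  exact: (leq_bigmax (F := fun t : 'I_T.+1 => N t) (Ordinal (tT : (t < T.+1)%N))).
have ex : exists t, (n < N t.+1)%N by exists n; apply: tN.
have [t nt tmin] := ex_minnP ex; exists t; split=> //.
  by rewrite leqNgt; apply/negP => /below; rewrite leqNgt nt.
case: t nt tmin => [|t] nt tmin; first exact: below.
by rewrite leqNgt; apply/negP => /tmin; rewrite ltnn.
Qed.

Lemma exists_glued (a : nat -> nat) (y : nat -> nat -> bool) :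
  {homo a : s t / (s <= t)%N} ->
  exists x : nat -> bool, forall t m, (a t <= m < a t.+1)%N -> x m = y t m.
Proof.
move=> amono.
have glue m : exists b : bool, forall t, (a t <= m < a t.+1)%N -> b = y t m.
  have [[t tm]|no] := pselect (exists t, a t <= m < a t.+1)%N; last first.
    by exists false => t tm; case: no; exists t.
  exists (y t m) => s sm; congr (y _ m).
  have := amono s.+1 t; have := amono t.+1 s; lia.
by have [x hx] := choice glue; exists x => t m /hx.
Qed.

(** Moving a window of length [P] by one step replaces its first term by an equal
    one at the other end. *)
Lemma sum_periodic_shift (R : realType) (P m : nat) (h : nat -> R) :
  (forall j, h (P + j)%N = h j) -> \sum_(o < P) h (m + o)%N = \sum_(o < P) h o.
Proof.
move=> per; elim: m => [|m IH]; first by apply: eq_bigr.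
rewrite -IH; case: P per {IH} => [|P] per; first by rewrite !big_ord0.
rewrite big_ord_recr big_ord_recl /= addrC; congr (_ + _).
  by rewrite addSnnS addnC per addn0.
by apply: eq_bigr => i _; rewrite addSnnS.
Qed.

(** A window of complete periods within one block sees the pattern with almost
    the right frequency, wherever it starts. *)
Lemma window_count (R : realType) (a : nat -> nat) (x : nat -> bool)
    (K : {fset nat}) (B : {ffun K -> bool}) (s q m M : nat) :
  (forall t j, (a t <= j < a t.+1)%N -> x j = champernowne t j) ->
  (forall i : K, fsval i <= M)%N ->
  (a s <= m)%N -> (m + q * period s + M <= a s.+1)%N ->
  `|\sum_(k < q * period s) (matches B x (m + k))%:R
      - (q * period s)%:R * (2^-1) ^+ (#|` K|) |
    <= (q * period s)%:R * (M%:R / s.+1%:R) :> R.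
Proof.
move=> hx KM am ma; pose h j : R := (matches B (champernowne s) j)%:R.
have per j p : h (p * period s + j)%N = h j.
  congr (nat_of_bool _)%:R; apply: eq_forallb => i.
  by rewrite addnCA champernowne_periodic.
have -> : \sum_(k < q * period s) (matches B x (m + k))%:R
    = q%:R * \sum_(o < period s) h o :> R.
  rewrite (eq_bigr (fun k : 'I__ => h (m + k)%N)); last first.
    move=> k _; congr (nat_of_bool _)%:R; apply: eq_forallb => i.
    by rewrite (hx s) //; have := KM i; have := ltn_ord k; lia.
  rewrite (sum_ord_mul _ _ (fun k => h (m + k)%N)).
  rewrite (eq_bigr (fun=> \sum_(o < period s) h o)) ?sumr_const ?card_ord ?mulr_natl //.
  move=> j _; rewrite -(sum_periodic_shift m); last first.
    by move=> i; rewrite -(per i 1%N) mul1n.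
  by apply: eq_bigr => o _; rewrite addnCA per.
rewrite natrM -mulrA -mulrBr normrM ger0_norm // -mulrA ler_wpM2l //.
apply: le_trans (champernowne_period_count R s B KM) _.
by rewrite /period !natrM -mulrA ler_wpM2l // mulrCA mulfV ?mulr1.
Qed.

(** * Normality *)

(** A set as large, invariant and bounded as a Følner set of index between [N t]
    and [N t.+1]. Its points are of two kinds: those whose window lies in a single
    block, the block of [t] or that of [t.+1], where the moving average is
    almost exact; and the [bad] ones, below [a t] or with a window straddling
    [a t.+1], which are too few to matter. The error collects [M] from the
    overflow between words, 1 from the bad points, 1 from averaging and
    [1 + #|` K|] from patterns leaving the set. *)
Lemma stage_estimate (R : realType) (a : nat -> nat) (x : nat -> bool) (t M : nat)
    (A K : {fset nat}) (B : {ffun K -> bool}) :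
  (forall s j, (a s <= j < a s.+1)%N -> x j = champernowne s j) ->
  A != fset0 -> K != fset0 -> 0%N \notin K -> (forall i : K, fsval i <= M)%N ->
  (M <= window t)%N ->
  (t.+1 * (a t + 2 * window t) <= #|` A|)%N ->
  (forall k, (0 < k <= window t)%N -> (t.+1 * escape A k <= #|` A|)%N) ->
  (forall m, m \in A -> (m + 2 * window t <= a t.+2)%N) ->
  `|(2^-1) ^+ (#|` K|) - (#|` A|%:R)^-1 * (count_occurrences B x A)%:R|
    <= (M + #|` K| + 3)%:R / t.+1%:R :> R.
Proof.
move=> hx A0 K0 K00 KM MS bigA invA topA.
set c := (2^-1) ^+ _; set u : R := #|` A|%:R; set v : R := t.+1%:R.
set w : R := (window t)%:R; pose g m : R := (matches B x m)%:R.
have u0 : 0 < u by rewrite ltr0n cardfs_gt0.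
have v0 : 0 < v by rewrite ltr0n.
have w0 : 0 < w by rewrite ltr0n /window /period !muln_gt0 !expn_gt0.
have c01 : 0 <= c <= 1.
  by rewrite exprn_ge0 ?invr_ge0 //= exprn_ile1 ?invr_ge0 // invf_le1 // ler1n.
have g01 m : 0 <= g m <= 1 by rewrite /g ler0n lern1 leq_b1.
have esc k : (k <= window t)%N -> (escape A k)%:R <= u / v.
  case: k => [_|k kS].
    rewrite (_ : escape A 0 = 0%N) ?divr_ge0 // ?ltW //.
    by apply/eqP; rewrite -leqn0 leqNgt -has_count; apply/hasPn => m; rewrite addn0 negbK.
  by rewrite ler_pdivlMr // mulrC -natrM ler_nat invA.
have occ : `|(count_occurrences B x A)%:R - \sum_(m <- A) g m| <= (1 + #|` K|)%:R * (u / v).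
  have [i0 i0K le1] := count_occurrences_close R B x A K0.
  apply: le_trans le1 _; rewrite natrD mulrDl mul1r; apply: lerD.
    by apply: esc; apply: leq_trans MS; exact: (KM [` i0K]%fset).
  apply: (@le_trans _ _ (\sum_(i : K) u / v)).
    by apply: ler_sum => i _; apply: esc; apply: leq_trans MS.
  by rewrite sumr_const -cardfE -[leLHS]mulr_natl.
pose W m : R := \sum_(k < window t) g (m + k)%N.
have avg : `|\sum_(m <- A) W m - w * \sum_(m <- A) g m| <= w * (u / v).
  apply: le_trans (dist_sum_window _ (fset_uniq A) g01) _.
  apply: (@le_trans _ _ (\sum_(k < window t) u / v)).
    by apply: ler_sum => k _; apply: esc; apply: ltnW.
  by rewrite sumr_const card_ord -[leLHS]mulr_natl.
(* Windows starting in the second interval may straddle [a t.+1]; doubling the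
   length leaves room for the pattern, as [M <= window t]. *)
pose bad := (iota 0 (a t) ++ iota (a t.+1 - 2 * window t) (2 * window t))%N.
have good m : m \in A -> m \notin bad -> `|W m - w * c| <= w * (M%:R / v).
  move=> mA; rewrite mem_cat !mem_iota negb_or => mbad; have top := topA m mA.
  have [am|am] := leqP (a t.+1) m.
    have wE : window t = (period t * period t.+1)%N by [].
    rewrite /W /w wE; apply: le_trans (window_count _ _ _ KM am _) _ => //.
      by rewrite -wE; move: MS top; clear; lia.
    by rewrite ler_wpM2l // ler_wpM2l // lef_pV2 ?posrE ?ltr0n // ler_nat.
  have wE : window t = (period t.+1 * period t)%N by rewrite /window mulnC.
  rewrite /W /w wE; apply: (window_count _ _ hx KM (s := t)); rewrite -?wE;
    by move: MS mbad am; clear; lia.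
have crude m : `|W m - w * c| <= w.
  have : 0 <= W m by apply: sumr_ge0 => k _; case/andP: (g01 (m + k)%N).
  have : W m <= w.
    rewrite /w -[X in X%:R]card_ord -sumr_const; apply: ler_sum => k _.
    by case/andP: (g01 (m + k)%N).
  by rewrite ler_norml; nra.
have badE : (size bad)%:R <= u / v.
  by rewrite ler_pdivlMr // mulrC -natrM ler_nat size_cat !size_iota.
have e0 : 0 <= w * (M%:R / v).
  by apply: mulr_ge0; [exact: ltW|apply: divr_ge0; [exact: ler0n|exact: ltW]].
have := sum_close_off_bad (fset_uniq A) e0 (ltW w0) good crude; rewrite -/u => tot.
have {}tot : `|\sum_(m <- A) W m - u * (w * c)| <= w * (u / v * (M%:R + 1)).
  have -> : w * (u / v * (M%:R + 1)) = u * (w * (M%:R / v)) + u / v * w by ring.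
  by apply: le_trans tot _; rewrite lerD2l ler_wpM2r // ltW.
pose G : R := \sum_(m <- A) g m.
have mean : `|G - u * c| <= u / v * (M%:R + 2).
  rewrite -(ler_pM2l w0) -{1}(gtr0_norm w0) -normrM.
  have -> : w * (G - u * c)
      = (\sum_(m <- A) W m - u * (w * c)) - (\sum_(m <- A) W m - w * G) by ring.
  have -> : w * (u / v * (M%:R + 2)) = w * (u / v * (M%:R + 1)) + w * (u / v) by ring.
  exact: le_trans (ler_normB _ _) (lerD tot avg).
have fin : `|(count_occurrences B x A)%:R - u * c| <= u * ((M + #|` K| + 3)%:R / v).
  have -> : u * ((M + #|` K| + 3)%:R / v) = (1 + #|` K|)%:R * (u / v) + u / v * (M%:R + 2).
    by rewrite !natrD; ring.
  rewrite -[X in `|X|](subrKA G).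
  exact: le_trans (ler_normD _ _) (lerD occ mean).
rewrite -(ler_pM2l u0); apply: le_trans fin.
rewrite -{1}(gtr0_norm u0) -normrM mulrBr mulrA mulfV ?gt_eqF // mul1r.
by rewrite distrC.
Qed.

(** Otherwise all counts would vanish, whereas their limit is positive. *)
Lemma normal_sequence_matches (R : realType) (F : nat -> {fset nat}) (x : nat -> bool)
    (K : {fset nat}) (B : {ffun K -> bool}) :
  normal_sequence R F x -> K != fset0 -> 0%N \notin K ->
  exists m, forall i : K, x (fsval i + m)%N = B i.
Proof.
move=> nx K0 K00; apply: contrapT => none.
have := nx K B K0 K00; rewrite (_ : (fun n => _) = fun=> 0).
  move/(cvg_unique (@Rhausdorff R) (cvg_cst 0)) => /esym/eqP.
  by rewrite expf_eq0 invr_eq0 pnatr_eq0 andbF.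
apply/funext => n; rewrite /count_occurrences (_ : occurrences B x (F n) = set0).
  by rewrite fset_set0 cardfs0 mulr0.
rewrite -subset0 => m occ; apply: none; exists m => i; exact: (occ i).2.
Qed.

(** Among the patterns that must occur are arbitrarily long runs of zeros, and a
    single 1 at any prescribed position [n.+1] of the pattern, hence beyond
    the digit [n]. *)
Lemma irrational_of_normal (R : realType) (F : nat -> {fset nat}) (x : nat -> bool) (r : R) :
  (forall n, 0 <= tail x r n <= 1) -> normal_sequence R F x -> irrational r.
Proof.
move=> tail01 nx; apply: (irrational_of_digits tail01) => [L|n].
  pose K := [fset k in iota 1 L.+1]%fset.
  have K0 : K != fset0 by apply/fset0Pn; exists 1%N; rewrite !inE.
  have K00 : 0%N \notin K by rewrite !inE mem_iota.
  have [m hm] := normal_sequence_matches [ffun=> false] nx K0 K00.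
  exists m => k kL; have kK : k \in K by rewrite !inE mem_iota; lia.
  by have := hm [` kK]%fset; rewrite ffunE addnC.
have K0 : [fset n.+1]%fset != fset0 by apply/fset0Pn; exists n.+1; rewrite inE.
have K00 : 0%N \notin [fset n.+1]%fset by rewrite inE.
have [m hm] := normal_sequence_matches [ffun=> true] nx K0 K00.
exists m; have := hm [` fset11 n.+1]%fset.
by rewrite ffunE.
Qed.

Theorem theorem8p1 (R : realType) (F : nat -> {fset nat})
    (hF : folner_sequence R F) :
  exists r : R, normal_number F r /\ liouville_number r.
Proof.
have [a [N [gap tN bigF invF topF]]] := exists_scales hF.
have amono : {homo a : s t / (s <= t)%N}.
  by apply: homo_leq => [//|? ? ?|t]; [exact: leq_trans|have := gap t; nia].
have [x hx] := exists_glued champernowne amono.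
have [r xr tail01] := binary_expansion_exists R x.
have nx : normal_sequence R F x.
  move=> K B K0 K00.
  pose M := (\max_(i <- K) i)%N.
  have KM (i : K) : (fsval i <= M)%N.
    by apply: (leq_bigmax_seq (P := xpredT) (F := id)) => //; exact: fsvalP.
  apply/cvgrPdist_le => eps eps0.
  pose C : R := (M + #|` K| + 3)%:R.
  have [T0 hT0] : exists T0 : nat, C / eps <= T0%:R.
    exists (Num.bound (C / eps)); apply/ltW/archi_boundP.
    by rewrite divr_ge0 // ltW.
  (* Stages beyond [T0] have error at most [eps], and from [M] on the windows are
     longer than the pattern. *)
  have [n0 hn0] := exists_stage (maxn T0 M) tN.
  exists n0 => // n /= /hn0 [t [Tt Nt nN]].
  have Mw : (M <= window t)%N.
    have : (0 < 2 ^ t.+1)%N by rewrite expn_gt0.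
    have : (0 < period t.+1)%N by rewrite /period muln_gt0 expn_gt0.
    by rewrite /window {2}/period; nia.
  have ww : (window t <= window t.+1)%N.
    have per s : (period s <= period s.+1)%N by rewrite leq_mul // leq_exp2l.
    by rewrite leq_mul.
  apply: le_trans (stage_estimate R B hx _ K0 K00 KM Mw (bigF t n Nt) (invF t n ^~ Nt) _) _.
  - by case: hF.
  - by move=> m mF; have := topF t.+1 n m nN mF; lia.
  rewrite ler_pdivrMr // mulrC -ler_pdivrMr //.
  apply: le_trans hT0 _; rewrite ler_nat; lia.
exists r; split; last split; last move=> k _.
- split; last by exists x.
  have := tail01 0%N.
  by rewrite /tail expr0 mul1r /digit_sum big_geq // subr0.
- exact: irrational_of_normal nx.
apply: (@approximation_of_period _ _ _ (a k) (period k) (a k.+1) k tail01).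
- by rewrite /period; have : (1 < 2 ^ k.+1)%N; [rewrite (@ltn_exp2l 2 0)|nia].
- by have := gap k; nia.
move=> m am mP; rewrite !(hx k); [|lia|lia].
by rewrite addnC -[X in champernowne _ (X + _)]mul1n champernowne_periodic.
Qed.
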